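(* Let $\alpha$ be an algebraic number of degree $6$ over $\mathbb{Q}$. There exist four distinct algebraic conjugates $\alpha_1,\alpha_2,\alpha_3,\alpha_4$ of $\alpha$ satisfying $$\alpha_{1}+\alpha_{2}=\alpha_{3}+\alpha_{4}\notin\mathbb{Q}$$ if and only if $\alpha$ equals the sum of a quadratic algebraic number and a cubic algebraic number.
   Context: Algebraic numbers, degrees and algebraic conjugates are over $\mathbb{Q}$. The algebraic conjugates of $\alpha$ (including $\alpha$ itself) are the complex roots of its minimal polynomial over $\mathbb{Q}$. A quadratic (respectively cubic) algebraic number is an algebraic number of degree exactly $2$ (respectively $3$) over $\mathbb{Q}$. *)

(* Defs.v *)
(* Mathematical Components. The field algC of complex algebraic numbers is
   algebraically closed, so it contains all complex conjugates of its
   elements. *)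
From mathcomp Require Import all_boot all_order all_algebra all_field.

Set Implicit Arguments.
Unset Strict Implicit.
Unset Printing Implicit Defensive.

Import GRing.Theory.
Local Open Scope ring_scope.

(* The size of a nonzero polynomial is its degree plus one. *)
Definition algdeg (x : algC) : nat := (size (minCpoly x)).-1.

Definition algconj (x y : algC) : bool := root (minCpoly x) y.

(* Main.v *)
Require Import Defs.
From HB Require Import structures.
From mathcomp Require Import all_boot all_order all_algebra all_field.
From mathcomp Require Import ring.
Import GRing.Theory Num.Theory.
Local Open Scope ring_scope.

(** The conjugates of an algebraic number are its images under the field
    automorphisms of algC ([conjugates_under_aut]), so the whole argument can be
    run with Galois orbits: finite duplicate-free lists on which the
    automorphisms act transitively.

    If alpha = b + c with b quadratic and c cubic, the six conjugates of alpha
    can only be the six sums bi + cj.  Hence these are distinct, and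
      (b1 + c1) + (b2 + c2) = (b1 + c2) + (b2 + c1),
    a number which is irrational because it differs from - c3 by a rational.

    Conversely, subtract a rational number from alpha so that the set A of its
    six conjugates has sum zero.  Let beta = a1 + a2 = a3 + a4 and let B be the
    set of conjugates of beta.  Applying automorphisms, every k in B cuts A
    into two pairs of sum k and a remaining pair P_k, whose sum is - 2k
    ([splits]).  An element of A is in P_k exactly when it has no partner of
    sum k, that is when it is not [paired] at k.

    - The set B has three elements ([size_sums]).  Fix x in A; sending k to the
      element that completes x to a pair of sum k or - 2k is injective, because
      conjugates never have ratio - 2 ([aut_orbit_ratio]).  So B has at most 5
      elements.  By transitivity each x is paired at the same number f of
      elements of B, and counting incidences gives 6 f = 4 #B.  Therefore
      #B = 3 and f = 2, so that each x lies in P_k for a single k.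
    - The elements of B add up to zero: weight the same double count by the
      elements of A ([sum_sums]).
    - For x in P_k the square of x + k depends neither on x nor on k
      ([unpaired_sqr]).  Inside P_k, replacing x by the other element changes
      the sign of x + k.  If k, l, m are the elements of B, then P_k and P_l
      together are cut into pairs of sum m.  Neither P_k nor P_l has this sum, so
      each of these pairs consists of some x in P_k and some y in P_l, and
      (x + k) + (y + l) = m + k + l = 0.

    So (x + k)^2 is fixed by all automorphisms, hence rational, and
    x = (x + k) + (- k) is the required decomposition, with - k cubic. *)

(** * Conjugates as orbits of automorphisms *)

(** Inside a number field that is generated by all roots of the minimal
    polynomial of x, the map x |-> y extends from Q(x) to the whole field,
    because that field is a splitting field; the automorphism thus obtained
    then extends to algC. *)
Lemma conjugates_under_aut (x y : algC) :
  algconj x y -> exists nu : {rmorphism algC -> algC}, nu x = y.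
Proof.
rewrite /algconj => xy.
have [p [Dp mon_p] dv_p] := minCpolyP x.
have [r Dr] := closed_field_poly_normal (minCpoly x).
rewrite (monicP (minCpoly_monic x)) scale1r in Dr.
have [L [LC [rr Drr genL]]] := num_field_exists r.
have LC_rat (q : {poly rat}) :
    map_poly LC (map_poly (in_alg L) q) = map_poly ratr q.
  rewrite -map_poly_comp; apply: eq_map_poly => a.
  by rewrite /= alg_num_field fmorph_rat.
have lift z : root (minCpoly x) z -> exists z1, LC z1 = z.
  by rewrite Dr root_prod_XsubC -Drr => /mapP[z1 _ ->]; exists z1.
have [x1 Dx] := lift x (root_minCpoly x); have [y1 Dy] := lift y xy.
have hom1: kHom 1 1 (\1%VF : 'End(L)) by rewrite kHom1.
have y1_root : root (map_poly \1%VF (minPoly 1 x1)) y1.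
  have -> : map_poly \1%VF (minPoly 1 x1) = minPoly 1 x1.
    by rewrite map_poly_id // => a _; rewrite id_lfunE.
  have /polyOver1P[q Dq] := minPolyOver 1 x1.
  rewrite Dq -(fmorph_root LC) LC_rat Dy.
  have : p %| q by rewrite -dv_p -LC_rat -Dq -Dx fmorph_root root_minPoly.
  by case/dvdpP=> s ->; rewrite rmorphM rootM /= -Dp xy orbT.
have hom_x1 := kHomExtendP (sub1v _) hom1 y1_root.
pose pL := map_poly (in_alg L) p.
have QpL : pL \is a polyOver 1%VS.
  by apply/polyOverP=> i; rewrite coef_map memvZ ?memv_line.
have splitL : splittingFieldFor 1 pL fullv.
  exists rr => //; congr (_ %= _): (eqpxx pL); apply/(map_poly_inj LC).
  rewrite LC_rat -Dp Dr -Drr big_map rmorph_prod /=; apply: eq_bigr => z _.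
  by rewrite map_polyXsubC.
have splitKL : splittingFieldFor <<1; x1>>%AS pL fullv.
  exact: splittingFieldForS (sub1v _) (subvf _) splitL.
have [f homf Df] := kHom_extends (sub1v _) hom_x1 QpL splitKL.
pose fM := GRing.isMonoidMorphism.Build _ _ f (kHom_monoid_morphism homf).
pose fRM : {rmorphism _ -> _} := HB.pack (fun_of_lfun f) fM.
have [nu Dnu] := extend_algC_subfield_aut LC fRM.
exists nu; rewrite -Dx -Dnu -Dy; congr (LC _); rewrite /= -Df ?memv_adjoin //.
exact: (kHomExtend_val hom1 y1_root).
Qed.

(** Separability over the rationals: at a double root y the derivative of the
    minimal polynomial would vanish, hence also at x since y is the image of x
    by an automorphism, but this derivative is nonzero of smaller degree. *)
Lemma minCpoly_roots (x : algC) :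
  exists2 r : seq algC, uniq r & minCpoly x = \prod_(z <- r) ('X - z%:P).
Proof.
have [r Dr] := closed_field_poly_normal (minCpoly x).
rewrite (monicP (minCpoly_monic x)) scale1r in Dr.
exists r => //; rewrite -separable_prod_XsubC -Dr.
have [p [Dp mon_p] dv_p] := minCpolyP x.
rewrite separable_poly.unlock; apply/negPn/negP => /negP ncop.
have /closed_rootP[y] : size (gcdp (minCpoly x) (minCpoly x)^`()) != 1%N.
  by apply/negP.
rewrite root_gcd => /andP[xy xy'].
have [nu Dy] := conjugates_under_aut _ _ xy.
have : p %| p^`().
  rewrite -dv_p -(fmorph_root nu) Dy -map_poly_comp.
  by rewrite (eq_map_poly (fmorph_rat nu)) -deriv_map -Dp.
have p_gt1 : (1 < size p)%N.
  by rewrite -(size_map_poly (@ratr algC)) -Dp size_minCpoly.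
rewrite gtNdvdp // ?lt_size_deriv ?(monic_neq0 mon_p) //.
apply/eqP=> /(congr1 (fun q : {poly rat} => q`_(size p).-2)).
have : p`_(size p).-1 = 1 by exact: (monicP mon_p).
rewrite coef_deriv coef0; case: (size p) p_gt1 => [|[|n]] //= _ -> /eqP.
by rewrite pnatr_eq0.
Qed.

(** The list of conjugates, in the form used for transport: algebraic degrees
    are computed below by exhibiting such lists. *)
Definition aut_orbit (x : algC) (r : seq algC) :=
  uniq r /\
  forall y, y \in r <-> exists nu : {rmorphism algC -> algC}, nu x = y.

Lemma aut_orbit_conj x :
  exists2 r, aut_orbit x r & forall y, (y \in r) = algconj x y.
Proof.
have [r Ur Dr] := minCpoly_roots x.
have rP y : (y \in r) = algconj x y by rewrite -root_prod_XsubC -Dr.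
exists r => //; split=> // y; rewrite rP.
split; first exact: conjugates_under_aut.
by case=> nu <-; rewrite /algconj -(minCpoly_aut nu) root_minCpoly.
Qed.

Lemma algdeg_orbit x r : aut_orbit x r -> algdeg x = size r.
Proof.
case=> Ur rP; have [s Us Ds] := minCpoly_roots x.
rewrite /algdeg Ds size_prod_XsubC; apply/perm_size/uniq_perm=> // y.
rewrite -root_prod_XsubC -Ds; apply/idP/idP.
  by move/conjugates_under_aut/rP.
by move/rP=> [nu <-]; rewrite -(minCpoly_aut nu) root_minCpoly.
Qed.

Lemma aut_fixed_Crat x :
  (forall nu : {rmorphism algC -> algC}, nu x = x) -> x \in Crat.
Proof.
move=> fix_x; have [r Ur Dr] := minCpoly_roots x.
have r_x y : y \in r -> y = x.
  by rewrite -root_prod_XsubC -Dr => /conjugates_under_aut[nu <-].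
have Ex: r = [:: x].
  have: x \in r by rewrite -root_prod_XsubC -Dr root_minCpoly.
  case: r Ur {Dr} r_x => [|y [|z r]] //= Ur r_x.
    by rewrite inE => /eqP->.
  case/andP: Ur => /norP[yz _] _ _.
  have Ey : y = x by apply: r_x; rewrite inE eqxx.
  have Ez : z = x by apply: r_x; rewrite !inE eqxx orbT.
  by rewrite Ey Ez eqxx in yz.
have [p [Dp _] _] := minCpolyP x.
have -> : x = - (minCpoly x)`_0.
  by rewrite Dr Ex big_seq1 coefB coefX coefC sub0r opprK.
by rewrite Dp coef_map rpredN Crat_rat.
Qed.

Lemma perm_map_stable (T : eqType) (f : T -> T) (r : seq T) :
    injective f -> uniq r -> (forall y, y \in r -> f y \in r) ->
  perm_eq (map f r) r.
Proof.
move=> inj_f Ur fr.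
have Ufr : uniq (map f r) by rewrite map_inj_uniq.
have sub_r : {subset map f r <= r} by move=> _ /mapP[y ry ->]; apply: fr.
have [_ Er] := uniq_min_size Ufr sub_r (eq_leq (esym (size_map f r))).
exact: uniq_perm.
Qed.

Lemma aut_orbit_id x r : aut_orbit x r -> x \in r.
Proof. by case=> _ rP; apply/rP; exists idfun. Qed.

Lemma aut_orbit_mem x r y : aut_orbit x r -> y \in r -> aut_orbit y r.
Proof.
move=> [Ur rP] /rP[nu <-]; split=> // z.
split=> [/rP[mu <-] | [mu <-]]; last by apply/rP; exists (mu \o nu).
by exists (mu \o algC_invaut nu); congr (mu _); apply: (algC_autK nu).
Qed.

Lemma aut_orbit_aut x r (nu : {rmorphism algC -> algC}) y :
  aut_orbit x r -> (nu y \in r) = (y \in r).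
Proof.
move=> Or; apply/idP/idP => ry; have [_ rP] := aut_orbit_mem _ _ _ Or ry.
  by apply/rP; exists (algC_invaut nu); apply: (algC_autK nu).
by apply/rP; exists nu.
Qed.

Lemma aut_orbit_perm x r (nu : {rmorphism algC -> algC}) :
  aut_orbit x r -> perm_eq (map nu r) r.
Proof.
move=> Or; apply: perm_map_stable; [exact: fmorph_inj | by case: Or |].
by move=> y; rewrite (aut_orbit_aut _ _ _ _ Or).
Qed.

(** Used for the maps y |-> y + q with q rational, and y |-> - y. *)
Lemma aut_orbit_equivariant (f : algC -> algC) x r :
    injective f ->
    (forall (nu : {rmorphism algC -> algC}) y, nu (f y) = f (nu y)) ->
  aut_orbit x r -> aut_orbit (f x) (map f r).
Proof.
move=> inj_f nuf [Ur rP]; split; first by rewrite map_inj_uniq.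
move=> y; split=> [/mapP[z /rP[nu <-] ->] | [nu <-]]; first by exists nu.
by rewrite nuf map_f //; apply/rP; exists nu.
Qed.

Lemma aut_orbit_translate x r q :
  q \in Crat -> aut_orbit x r -> aut_orbit (x + q) [seq y + q | y <- r].
Proof.
move=> Qq; apply: (aut_orbit_equivariant (+%R^~ q)); first exact: addIr.
by move=> nu y; rewrite rmorphD /= (aut_Crat nu Qq).
Qed.

Lemma aut_orbit_Crat x r : aut_orbit x r -> x \in Crat -> size r = 1%N.
Proof.
move=> Or Qx; rewrite -(algdeg_orbit _ _ Or); apply: (algdeg_orbit x [:: x]).
split=> // y; rewrite inE; split=> [/eqP-> | [nu <-]]; first by exists idfun.
by rewrite (aut_Crat nu Qx).
Qed.

Lemma aut_orbit_sum x r : aut_orbit x r -> \sum_(y <- r) y \in Crat.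
Proof.
move=> Or; apply: aut_fixed_Crat => nu; rewrite rmorph_sum /=.
by rewrite -[RHS](perm_big _ (aut_orbit_perm _ _ nu Or)) big_map.
Qed.

(** Automorphisms send b to b or - b, and one of them moves b. *)
Lemma algdeg_sqrt b : b ^+ 2 \in Crat -> b \notin Crat -> algdeg b = 2%N.
Proof.
move=> Qb2 nQb; have [r Or _] := aut_orbit_conj b; have [_ rP] := Or.
have nu_b (nu : {rmorphism algC -> algC}) : nu b = b \/ nu b = - b.
  have /eqP : nu b ^+ 2 = b ^+ 2 by rewrite -rmorphXn /= (aut_Crat nu Qb2).
  by rewrite eqf_sqr => /orP[]/eqP; [left | right].
have rNb : - b \in r.
  apply: contraNT nQb => nrNb; apply: aut_fixed_Crat => nu.
  case: (nu_b nu) => // nuNb; case/negP: nrNb; apply/rP; by exists nu.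
apply: (algdeg_orbit b [:: b; - b]); split=> [|y].
  rewrite /= inE andbT eq_sym eqNr; apply: contra nQb => /eqP->.
  exact: rpred0.
rewrite !inE; split=> [/orP[]/eqP-> | [nu <-]].
- by exists idfun.
- exact/rP.
- by case: (nu_b nu) => ->; rewrite eqxx ?orbT.
Qed.

(** If y = - 2z for two conjugates then, by transitivity, the orbit is stable
    under w |-> - 2w; this map permutes the orbit but doubles the sum of the
    absolute values, so that all conjugates would vanish. *)
Lemma aut_orbit_ratio x r y z :
  aut_orbit x r -> x != 0 -> y \in r -> z \in r -> y != - (z *+ 2).
Proof.
move=> Or nz_x ry rz; apply/eqP=> Dy.
pose f (w : algC) := - (w *+ 2).
have fr w : w \in r -> f w \in r.
  move=> rw; have [_ /(_ w)[]] := aut_orbit_mem _ _ _ Or rz.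
  move=> /(_ rw)[nu <-] _.
  by rewrite /f -rmorphMn -rmorphN /= -Dy (aut_orbit_aut _ _ _ _ Or).
have inj_f : injective f.
  by move=> u v /oppr_inj/eqP; rewrite eqr_pMn2r // => /eqP.
have fr_perm := perm_map_stable _ _ _ inj_f (proj1 Or) fr.
have : \sum_(w <- map f r) `|w| = \sum_(w <- r) `|w| by apply: perm_big.
rewrite big_map /f; under eq_bigr do rewrite normrN normrMn.
rewrite sumrMnl mulr2n => /eqP; rewrite -subr_eq0 addrK.
rewrite psumr_eq0 // => /allP/(_ x (aut_orbit_id _ _ Or)).
by rewrite /= normr_eq0 (negPf nz_x).
Qed.

(** * Cutting six numbers into pairs *)

(** The second condition excludes an x equal to half of k, so that the element
    completing x to k is always another one. *)
Definition paired (A : seq algC) (k x : algC) : bool :=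
  (k - x \in A) && (k - x != x).

Definition splits (A : seq algC) (k : algC) : Prop :=
  exists a1 a2 a3 a4 a5 a6 : algC,
    [/\ perm_eq A [:: a1; a2; a3; a4; a5; a6],
        a1 + a2 = k, a3 + a4 = k & a5 + a6 = - (k *+ 2)].

(** The four numbers of the two pairs of sum k are paired, and the remaining
    two are not: a5 cannot be completed to k by one of a1, ..., a4, whose
    partners are already known, nor by a6, since k <> - 2k. *)
Lemma splits_paired A k : uniq A -> k != 0 -> splits A k ->
  [/\ count (paired A k) A = 4%N,
      \sum_(x <- A | paired A k x) x = k *+ 2
    & forall x, x \in A -> ~~ paired A k x ->
      exists2 x', x + x' = - (k *+ 2) &
        perm_eq [seq y <- A | ~~ paired A k y] [:: x; x']].
Proof.
move=> UA nz_k [a1 [a2 [a3 [a4 [a5 [a6 [pA S12 S34 S56]]]]]]].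
have memA z : (z \in A) = (z \in [:: a1; a2; a3; a4; a5; a6]).
  exact: perm_mem.
have : uniq [:: a1; a2; a3; a4; a5; a6] by rewrite -(perm_uniq pA).
rewrite /= !inE !negb_or -!andbA.
case/and5P=> n12 n13 n14 n15 /and5P[n16 n23 n24 n25 /and5P[n26 n34 n35 n36]].
case/and4P=> n45 n46 n56 _.
have S21 : a2 + a1 = k by rewrite addrC.
have S43 : a4 + a3 = k by rewrite addrC.
have pairedI u v : u + v = k -> v \in A -> v != u -> paired A k u.
  by move=> <- vA vu; rewrite /paired addrC addKr vA.
have [A1 A2 A3 A4] : [/\ a1 \in A, a2 \in A, a3 \in A & a4 \in A].
  by rewrite !memA !inE !eqxx !orbT.
have P1 : paired A k a1 by apply: (pairedI _ _ S12 A2); rewrite eq_sym.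
have P2 : paired A k a2 by apply: (pairedI _ _ S21 A1).
have P3 : paired A k a3 by apply: (pairedI _ _ S34 A4); rewrite eq_sym.
have P4 : paired A k a4 by apply: (pairedI _ _ S43 A3).
have unpaired u v : u + v = - (k *+ 2) -> u \notin [:: a1; a2; a3; a4] ->
    {subset A <= [:: a1; a2; a3; a4; u; v]} -> ~~ paired A k u.
  move=> Suv; rewrite !inE !negb_or => /and4P[u1 u2 u3 u4] sA.
  apply/negP => /andP[/sA kuA ku].
  have kw w w' : w + w' = k -> u != w -> k - u != w'.
    move=> <-; apply: contraNneq => e; apply/eqP/(addIr w').
    by rewrite -[in LHS]e; ring.
  move: kuA; rewrite !inE (negPf (kw a2 a1 S21 u2)).
  rewrite (negPf (kw a1 a2 S12 u1)) (negPf (kw a4 a3 S43 u4)).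
  rewrite (negPf (kw a3 a4 S34 u3)) (negPf ku) /= subr_eq addrC Suv -addr_eq0.
  by rewrite -mulrS mulrn_eq0 (negPf nz_k).
have U5 : ~~ paired A k a5.
  apply: (unpaired _ a6) => [//||z]; last by rewrite memA.
  by rewrite !inE !negb_or 4!(eq_sym a5) n15 n25 n35 n45.
have U6 : ~~ paired A k a6.
  apply: (unpaired _ a5) => [||z]; first by rewrite addrC.
    by rewrite !inE !negb_or 4!(eq_sym a6) n16 n26 n36 n46.
  by rewrite memA !inE [(z == a5) || _]orbC.
have p4 : perm_eq (filter (paired A k) A) [:: a1; a2; a3; a4].
  apply: perm_trans (perm_filter _ pA) _; rewrite /=.
  by rewrite P1 P2 P3 P4 (negPf U5) (negPf U6).
have p2 : perm_eq [seq y <- A | ~~ paired A k y] [:: a5; a6].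
  by apply: perm_trans (perm_filter _ pA) _; rewrite /= P1 P2 P3 P4 U5 U6.
split=> [||x Ax Ux].
- by rewrite -size_filter (perm_size p4).
- rewrite -big_filter (perm_big _ p4) !big_cons big_nil /= addr0 addrA S12 S34.
  by rewrite mulr2n.
have : x \in [:: a5; a6] by rewrite -(perm_mem p2) mem_filter Ux.
rewrite !inE => /orP[]/eqP->; first by exists a6.
exists a5; first by rewrite addrC.
by apply: perm_trans p2 _; rewrite (perm_catC [:: a5] [:: a6]).
Qed.

Lemma paired_aut x A (nu : {rmorphism algC -> algC}) k y :
  aut_orbit x A -> paired A (nu k) (nu y) = paired A k y.
Proof.
move=> OA; rewrite /paired -rmorphB /= (aut_orbit_aut _ _ _ _ OA).
by rewrite (inj_eq (fmorph_inj nu)).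
Qed.

Lemma splits_aut x A (nu : {rmorphism algC -> algC}) k :
  aut_orbit x A -> splits A k -> splits A (nu k).
Proof.
move=> OA [a1 [a2 [a3 [a4 [a5 [a6 [pA S12 S34 S56]]]]]]].
exists (nu a1), (nu a2), (nu a3), (nu a4), (nu a5), (nu a6).
rewrite -!rmorphD /= S12 S34 S56 rmorphN rmorphMn; split=> //.
have := aut_orbit_perm _ _ nu OA; rewrite perm_sym => /perm_trans; apply.
exact: (perm_map nu pA).
Qed.

(** The last two elements of A have sum - 2k because A has sum zero. *)
Lemma splits_sum A a1 a2 a3 a4 : uniq A -> size A = 6%N ->
    \sum_(x <- A) x = 0 -> uniq [:: a1; a2; a3; a4] ->
    {subset [:: a1; a2; a3; a4] <= A} -> a1 + a2 = a3 + a4 ->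
  splits A (a1 + a2).
Proof.
set s := [:: a1; a2; a3; a4] => UA szA sumA Us sA S.
pose t := [seq x <- A | x \notin s].
have pA : perm_eq A (s ++ t).
  rewrite -(perm_filterC [in s] A) perm_cat2r.
  apply: uniq_perm; rewrite ?filter_uniq // => x.
  by rewrite mem_filter; apply: andb_idr; apply: sA.
have : size t = 2%N by have := perm_size pA; rewrite szA size_cat => -[].
case: t pA => [|a5 [|a6 [|]]] // pA _.
exists a1, a2, a3, a4, a5, a6; split=> //.
move: sumA; rewrite (perm_big _ pA) !big_cons big_nil /= addr0.
move=> /eqP; rewrite !addrA -[_ + a3 + a4]addrA -S -addrA addrC addr_eq0.
by move/eqP->; rewrite mulr2n.
Qed.

Lemma sum_count_exchange (T U : eqType) (P : U -> T -> bool) A (B : seq U) :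
  (\sum_(x <- A) count (P^~ x) B = \sum_(k <- B) count (P k) A)%N.
Proof.
under eq_bigr do rewrite -sum1_count big_mkcond.
rewrite exchange_big; apply: eq_bigr => k _.
by rewrite -sum1_count [RHS]big_mkcond.
Qed.

Lemma sum_nat_const_on (T : eqType) (F : T -> nat) s c :
  {in s, forall x, F x = c} -> (\sum_(x <- s) F x = size s * c)%N.
Proof.
move=> Fc; rewrite -sum1_size big_distrl /= big_seq [RHS]big_seq.
by apply: eq_bigr => x sx; rewrite mul1n Fc.
Qed.

Lemma paired_count_const x A k B y :
  aut_orbit x A -> aut_orbit k B -> y \in A ->
  count ((paired A)^~ y) B = count ((paired A)^~ x) B.
Proof.
move=> OA OB; have [_ AP] := OA; case/AP=> nu <-.
rewrite -(permP (aut_orbit_perm _ _ nu OB)) count_map.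
by apply: eq_count => l; apply: paired_aut OA.
Qed.

(** * The three conjugates of the pair sum *)

Section PairSumOrbit.
Context (x0 k0 : algC) (A B : seq algC).
Context (OA : aut_orbit x0 A) (OB : aut_orbit k0 B).
Context (szA : size A = 6%N) (sumA : \sum_(x <- A) x = 0).
Context (nz_k0 : k0 != 0) (spl : splits A k0).

Let UA : uniq A. Proof. by case: OA. Qed.
Let UB : uniq B. Proof. by case: OB. Qed.

Let splB k : k \in B -> splits A k.
Proof. by case: OB => _ BP /BP[nu <-]; apply: splits_aut OA _. Qed.
Let nzB k : k \in B -> k != 0.
Proof. by case: OB => _ BP /BP[nu <-]; rewrite fmorph_eq0. Qed.

(** The element of A completing x0 to a pair of sum k or - 2k determines k:
    a sum of the first kind is never one of the second kind for another k. *)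
Lemma size_sums_le5 : (size B <= 5)%N.
Proof.
have Ax := aut_orbit_id _ _ OA.
pose g k := if paired A k x0 then k - x0 else - (k *+ 2) - x0.
have inj_g : {in B &, injective g}.
  move=> k l Bk Bl; rewrite /g.
  case: ifP => _; case: ifP => _ /addIr // e.
  - by have := aut_orbit_ratio _ _ _ _ OB nz_k0 Bk Bl; rewrite e eqxx.
  - by have := aut_orbit_ratio _ _ _ _ OB nz_k0 Bl Bk; rewrite e eqxx.
  - by move/oppr_inj/eqP: e; rewrite eqr_pMn2r // => /eqP.
have gA : {subset map g B <= rem x0 A}.
  move=> _ /mapP[k Bk ->]; rewrite mem_rem_uniq // inE /g andbC.
  have [_ _ unp] := splits_paired _ _ UA (nzB _ Bk) (splB _ Bk).
  case: ifP => [// | /negbT Ux]; have [x' <- px'] := unp _ Ax Ux.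
  rewrite addrC addKr.
  have: uniq [:: x0; x'] by rewrite -(perm_uniq px') filter_uniq.
  have: x' \in [:: x0; x'] by rewrite !inE eqxx orbT.
  rewrite -(perm_mem px') mem_filter => /andP[_ ->] /=.
  by rewrite inE andbT eq_sym.
have := uniq_leq_size _ gA; rewrite map_inj_in_uniq // size_map size_rem //.
by rewrite szA; apply.
Qed.

(** Writing n for the size of B and f for the number of elements of B at which
    x0 is paired, the double count reads 6 f = 4 n; with 0 < n <= 5 it leaves
    only n = 3 and f = 2. *)
Lemma size_sums : size B = 3%N /\ count ((paired A)^~ x0) B = 2%N.
Proof.
have := sum_count_exchange _ _ (paired A) A B.
rewrite (sum_nat_const_on _ _ _ (count ((paired A)^~ x0) B)); last first.
  by move=> y Ay; apply: paired_count_const OA OB Ay.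
rewrite (sum_nat_const_on _ _ B 4) => [|k Bk]; last first.
  by have [] := splits_paired _ _ UA (nzB _ Bk) (splB _ Bk).
have : (0 < size B)%N by case: B (aut_orbit_id _ _ OB).
have := size_sums_le5; have := count_size ((paired A)^~ x0) B; rewrite szA.
move: (size B) (count _ B) => n c.
by case: n => [|[|[|[|[|[|n]]]]]]; case: c => [|[|[|[|[|[|c]]]]]].
Qed.

(** In the double sum of x over the incidences of x with k, each x is counted
    twice, which gives zero, while each k contributes k + k. *)
Lemma sum_sums : \sum_(k <- B) k = 0.
Proof.
have [_ c2] := size_sums.
have : \sum_(k <- B) \sum_(x <- A | paired A k x) x = 0.
  under eq_bigr do rewrite big_mkcond.
  rewrite exchange_big /= big_seq.
  under eq_bigr => x Ax do
    rewrite -big_mkcond big_const_seq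
            (paired_count_const _ _ _ _ _ OA OB Ax) c2.
  rewrite -big_seq /=; under eq_bigr do rewrite addr0 -mulr2n.
  by rewrite sumrMnl sumA mul0rn.
rewrite big_seq.
under eq_bigr => k Bk do
  have [_ -> _] := splits_paired _ _ UA (nzB _ Bk) (splB _ Bk).
by rewrite -big_seq sumrMnl => /eqP; rewrite mulrn_eq0 => /eqP.
Qed.

Lemma unpaired_unique x : x \in A ->
  exists2 k, k \in B & forall l, l \in B -> ~~ paired A l x = (l == k).
Proof.
move=> Ax; have [n3 c2] := size_sums.
have : size [seq k <- B | ~~ paired A k x] = 1%N.
  have := count_predC ((paired A)^~ x) B.
  rewrite (paired_count_const _ _ _ _ _ OA OB Ax) c2 n3 size_filter.
  by move/eqP; rewrite -[3%N]/(2 + 1)%N eqn_add2l => /eqP.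
case E: [seq _ <- _ | _] => [|k []] // _; exists k.
  by have := mem_head k [::]; rewrite -E mem_filter => /andP[].
by move=> l Bl; rewrite -[l == k]mem_seq1 -E mem_filter Bl andbT.
Qed.

(** This makes the square of x + k invariant under automorphisms. *)
Lemma unpaired_sqr x y k l : x \in A -> y \in A -> k \in B -> l \in B ->
  ~~ paired A k x -> ~~ paired A l y -> (x + k) ^+ 2 = (y + l) ^+ 2.
Proof.
move=> Ax Ay Bk Bl Ux Uy.
have pairOf z j : z \in A -> j \in B -> ~~ paired A j z ->
    exists2 z', z + z' = - (j *+ 2) &
      forall w, w \in A -> ~~ paired A j w -> w = z \/ w = z'.
  move=> Az Bj Uz.
  have [_ _ unp] := splits_paired _ _ UA (nzB _ Bj) (splB _ Bj).
  have [z' Szz' pz'] := unp _ Az Uz; exists z' => // w Aw Uw.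
  have : w \in [:: z; z'] by rewrite -(perm_mem pz') mem_filter Uw.
  by rewrite !inE => /orP[]/eqP; [left | right].
have [x' Sx xP] := pairOf _ _ Ax Bk Ux.
have Dx' : x' = - (k *+ 2) - x by rewrite -Sx addrC addKr.
have [kl | nkl] := eqVneq k l.
  (* In the pair of sum - 2k, exchanging the elements negates x + k. *)
  subst l; have [-> // | ->] := xP _ Ay Uy; rewrite Dx'; ring.
have [y' Sy yP] := pairOf _ _ Ay Bl Uy.
have Dy' : y' = - (l *+ 2) - y by rewrite -Sy addrC addKr.
have [m pB] : exists m, perm_eq B [:: k; l; m].
  have p1 := perm_to_rem Bk; have Bl' : l \in rem k B.
    by rewrite mem_rem_uniq // inE eq_sym nkl.
  have p2 := perm_to_rem Bl'; have [n3 _] := size_sums.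
  have := perm_size p2; rewrite size_rem // n3.
  case: (rem l _) p2 => [|m []] // p2 _; exists m.
  by apply: perm_trans p1 _; rewrite perm_cons.
have Bm : m \in B by rewrite (perm_mem pB) !inE eqxx !orbT.
have Dm : m = - k - l.
  have := sum_sums; rewrite (perm_big _ pB) !big_cons big_nil /= addr0.
  by move=> /eqP; rewrite addrA addrC addr_eq0 opprD => /eqP.
have Px : paired A m x.
  have [k1 _ k1P] := unpaired_unique _ Ax.
  apply/negPn; rewrite k1P //.
  move: Ux; rewrite k1P // => /eqP <-; rewrite eq_sym; have := UB.
  by rewrite (perm_uniq pB) /= !inE negb_or => /and3P[/andP[]].
(* The partner z of x at m lies in some P_q; it is in none of P_k and P_m,
   so it belongs to P_l and equals y or y'. *)
pose z := m - x; have /andP[] := Px; rewrite -/z => Az zx.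
have Pz : paired A m z.
  by rewrite /paired (subKr m x) Ax eq_sym.
have [q Bq qP] := unpaired_unique _ Az.
have Uz : ~~ paired A q z by rewrite qP.
have : q \in [:: k; l; m] by rewrite -(perm_mem pB).
rewrite !inE => /or3P[] /eqP Dq; subst q.
- have [zx' | zx'] := xP _ Az Uz; first by rewrite zx' eqxx in zx.
  have := aut_orbit_ratio _ _ _ _ OB nz_k0 Bm Bk.
  by rewrite -Sx -zx' /z addrC subrK eqxx.
- have -> : x = m - z by rewrite /z subKr.
  by have [-> | ->] := yP _ Az Uz; rewrite ?Dy' Dm; ring.
by rewrite Pz in Uz.
Qed.

(** Here x0 is alpha after translation; the term - k is the half sum of the
    pair P_k to which x0 belongs. *)
Lemma decomposition_up_to_translation :
  exists b c r, [/\ b ^+ 2 \in Crat, aut_orbit c r, size r = 3%N & x0 = b + c].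
Proof.
have Ax := aut_orbit_id _ _ OA.
have [k Bk kP] := unpaired_unique _ Ax.
have Ux : ~~ paired A k x0 by rewrite kP.
exists (x0 + k), (- k), [seq - l | l <- B]; split; last by rewrite addrK.
- apply: aut_fixed_Crat => nu; rewrite rmorphXn rmorphD /=.
  apply: unpaired_sqr; rewrite ?(aut_orbit_aut _ _ _ _ OA) //.
    by rewrite (aut_orbit_aut _ _ _ _ OB).
  by rewrite (paired_aut _ _ _ _ _ OA).
- apply: (aut_orbit_equivariant (@GRing.opp algC)); first exact: oppr_inj.
    by move=> nu y; rewrite rmorphN.
  exact: aut_orbit_mem OB Bk.
by rewrite size_map; case: size_sums.
Qed.

End PairSumOrbit.

(** * The two implications *)

(** The conjugates are translated by the rational q = - (their mean).  The
    quadratic part is irrational: otherwise alpha would be a rational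
    translate of a cubic number. *)
Lemma sum_quadratic_cubic alpha a1 a2 a3 a4 :
    algdeg alpha = 6%N -> uniq [:: a1; a2; a3; a4] ->
    all (algconj alpha) [:: a1; a2; a3; a4] ->
    a1 + a2 = a3 + a4 -> a1 + a2 \notin Crat ->
  exists b c, [/\ algdeg b = 2%N, algdeg c = 3%N & alpha = b + c].
Proof.
move=> deg6 Us sA S nQ.
have [A OA AP] := aut_orbit_conj alpha.
have szA : size A = 6%N by rewrite -(algdeg_orbit _ _ OA).
pose q := - ((\sum_(y <- A) y) / 6%:R).
have Qq : q \in Crat.
  by rewrite rpredN rpred_div ?rpred_nat // (aut_orbit_sum _ _ OA).
pose A' := [seq y + q | y <- A].
have OA' : aut_orbit (alpha + q) A' by apply: aut_orbit_translate.
have sumA' : \sum_(y <- A') y = 0.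
  rewrite big_map big_split /= big_const_seq count_predT szA /=.
  by rewrite /q; field.
pose beta := (a1 + q) + (a2 + q).
have Dbeta : a1 + a2 = beta - (q + q) by rewrite /beta; ring.
have [B OB _] := aut_orbit_conj beta.
have nz_beta : beta != 0.
  by apply: contraNneq nQ => b0; rewrite Dbeta b0 sub0r rpredN rpredD.
have spl : splits A' beta.
  apply: (splits_sum _ _ _ (a3 + q) (a4 + q)); rewrite ?size_map //.
  - by case: OA'.
  - by have := map_inj_uniq (addIr q) [:: a1; a2; a3; a4]; rewrite Us.
  - move=> y; rewrite -[X in y \in X]/[seq z + q | z <- [:: a1; a2; a3; a4]].
    by case/mapP=> z /(allP sA) az ->; apply: (map_f (+%R^~ q)); rewrite AP.
  - by rewrite addrACA S addrACA.
have szA' : size A' = 6%N by rewrite size_map.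
have [b [c [r [Qb2 Oc szr Dx]]]] :=
  decomposition_up_to_translation _ _ _ _ OA' OB szA' sumA' nz_beta spl.
have Qnq : - q \in Crat by rewrite rpredN.
have deg_t t : t \in Crat -> algdeg (c + t) = 3%N.
  move=> Qt; have Oct := aut_orbit_translate _ _ _ Qt Oc.
  by rewrite (algdeg_orbit _ _ Oct) size_map.
have Da : alpha = b + (c - q) by rewrite addrA -Dx addrK.
exists b, (c - q); split; [apply: algdeg_sqrt => // | exact: deg_t | exact: Da].
apply/negP => Qb; move: deg6; rewrite Da addrC -addrA deg_t //.
by rewrite rpredD.
Qed.

(** The six conjugates lie among the six sums bi + cj, listed in an order that
    puts the four numbers of the relation first. *)
Lemma conj_sum_quadratic_cubic alpha b c :
    algdeg alpha = 6%N -> algdeg b = 2%N -> algdeg c = 3%N -> alpha = b + c ->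
  exists a1 a2 a3 a4 : algC,
     [/\ uniq [:: a1; a2; a3; a4],
         all (algconj alpha) [:: a1; a2; a3; a4],
         a1 + a2 = a3 + a4
       & a1 + a2 \notin Crat].
Proof.
move=> degA degB degC Da.
have [A OA AP] := aut_orbit_conj alpha.
have [rb Ob _] := aut_orbit_conj b; have [rc Oc _] := aut_orbit_conj c.
move: degA degB degC.
rewrite (algdeg_orbit _ _ OA) (algdeg_orbit _ _ Ob) (algdeg_orbit _ _ Oc).
move=> szA; case: rb Ob => [|b1 [|b2 []]] // Ob _.
case: rc Oc => [|c1 [|c2 [|c3 []]]] // Oc _.
pose S := [:: b1 + c1; b2 + c2; b1 + c2; b2 + c1; b1 + c3; b2 + c3].
have sAS : {subset A <= S}.
  move=> y; case: (OA) => _ AP' /AP'[nu <-]; rewrite Da rmorphD /=.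
  have : nu b \in [:: b1; b2].
    by rewrite (aut_orbit_aut _ _ _ _ Ob) (aut_orbit_id _ _ Ob).
  have : nu c \in [:: c1; c2; c3].
    by rewrite (aut_orbit_aut _ _ _ _ Oc) (aut_orbit_id _ _ Oc).
  rewrite !inE.
  by move=> /or3P[]/eqP-> /orP[]/eqP->; rewrite eqxx ?orbT.
have szS : (size S <= size A)%N by rewrite szA.
have [UA _] := OA.
have [_ SA] := uniq_min_size UA sAS szS.
have := leq_size_uniq UA sAS szS; rewrite -[S](cat_take_drop 4) cat_uniq.
case/andP=> US _; exists (b1 + c1), (b2 + c2), (b1 + c2), (b2 + c1).
split=> //.
- by apply/allP=> y Sy; rewrite -AP SA -[S](cat_take_drop 4) mem_cat Sy.
- by ring.
apply/negP => QS.
have := aut_orbit_sum _ _ Ob; have := aut_orbit_sum _ _ Oc.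
rewrite !big_cons !big_nil /= !addr0 => Qc Qb.
have Oc3 : aut_orbit c3 [:: c1; c2; c3].
  by apply: aut_orbit_mem Oc _; rewrite !inE eqxx !orbT.
suffices : size [:: c1; c2; c3] = 1%N by [].
apply: (aut_orbit_Crat _ _ Oc3).
have -> : c3 = (b1 + b2) + (c1 + (c2 + c3)) - (b1 + c1 + (b2 + c2)) by ring.
by rewrite rpredB // rpredD.
Qed.

Theorem theorem3 (alpha : algC) (deg_alpha : algdeg alpha = 6%N) :
  (exists a1 a2 a3 a4 : algC,
     [/\ uniq [:: a1; a2; a3; a4],
         [/\ algconj alpha a1, algconj alpha a2,
             algconj alpha a3 & algconj alpha a4],
         a1 + a2 = a3 + a4
       & a1 + a2 \notin Crat])
  <->
  (exists b c : algC,
     [/\ algdeg b = 2%N, algdeg c = 3%N & alpha = b + c]).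
Proof.
split=> [[a1 [a2 [a3 [a4 [Us [A1 A2 A3 A4] S nQ]]]]] | [b [c [db dc Da]]]].
  by apply: sum_quadratic_cubic deg_alpha Us _ S nQ; rewrite /= A1 A2 A3 A4.
have [a1 [a2 [a3 [a4 [Us /= /and5P[A1 A2 A3 A4 _] S nQ]]]]] :=
  conj_sum_quadratic_cubic _ _ _ deg_alpha db dc Da.
by exists a1, a2, a3, a4; split.
Qed.
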